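(* For any integer $r\geq 1$, we have $$\sum_{k=0}^r\left(e_{k-1}e_{k-1}e_{r-k}e_{r-k}+e_{k-2}e_{k}e_{r-k}e_{r-k}-2e_{k-1}e_{k}e_{r-k-1}e_{r-k}\right)=\sum_{\lambda}s_{\lambda},$$ where $\lambda$ ranges over all partitions of $2r-2$ of the form $(4^{i_4},3^{2i_3},2^{2i_2},1^{2i_1})$ with $i_1,i_2,i_3,i_4$ nonnegative integers.
   Context: Symmetric functions are in infinitely many variables $x_1,x_2,\ldots$. $e_k$ is the $k$-th elementary symmetric function, with $e_0=1$ and $e_k=0$ for $k<0$. $s_\lambda$ is the Schur function of the partition $\lambda$, with $s_\emptyset=1$. The notation $(4^{m_4},3^{m_3},2^{m_2},1^{m_1})$ denotes the partition with exactly $m_i$ parts equal to $i$ for $1\le i\le 4$ and no other parts. *)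

(* Defs.v *)
From HB Require Import structures.
From mathcomp Require Import all_boot all_order all_algebra finmap multiset.
From mathcomp Require Import boolp classical_sets functions cardinality fsbigop.

Set Implicit Arguments.
Unset Strict Implicit.
Unset Printing Implicit Defensive.
Import Order.TTheory GRing.Theory Num.Theory.

Local Open Scope classical_set_scope.
Local Open Scope ring_scope.

(* A monomial in the variables x_0, x_1, x_2, ... is the finite multiset of
   the indices of its variables; the product of monomials is msetD.  The
   variables are numbered from 0 instead of 1. *)
Notation monomial := {mset nat}%mset.

(* Integral formal power series in infinitely many variables: the ambient ring
   of the ring of symmetric functions.  A record, so that the pointwise ring
   structure which functions.v puts on function types is not used. *)
Record fps := Fps { coef : monomial -> int }.

Lemma fpsP (f g : fps) : coef f =1 coef g -> f = g.
Proof. by case: f g => [f] [g] /= /funext ->. Qed.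

HB.instance Definition _ := gen_eqMixin fps.
HB.instance Definition _ := gen_choiceMixin fps.

Definition fps0 := Fps (fun=> 0).
Definition fps1 := Fps (fun m => (m == mset0)%:R).
Definition fps_opp f := Fps (fun m => - coef f m).
Definition fps_add f g := Fps (fun m => coef f m + coef g m).
Definition fps_mul f g := Fps (fun m =>
  \sum_(a \in [set a | msubset a m]) coef f a * coef g (msetB m a)).

Lemma finite_submonomials (m : monomial) :
  finite_set [set a : monomial | msubset a m].
Proof.
pose F (b : (size m).-tuple bool) : monomial := seq_mset (mask b m).
apply: (@sub_finite_set _ _ (F @` [set: (size m).-tuple bool])); last first.
  exact: finite_image finite_finset.
move=> a /= am.
have /count_subseqP[s sm pas] : forall x, (count_mem x a <= count_mem x m)%N.
  by move=> x; rewrite !count_mem_mset; exact: (msubsetP am).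
have [b sb sE] := subseqP sm.
exists (Tuple (introT eqP sb)) => //=.
by rewrite /F /= -sE -[RHS]seq_mset_id; apply/eq_seq_msetP; rewrite perm_sym.
Qed.

Definition submonomials (m : monomial) : seq monomial :=
  fset_set [set a : monomial | msubset a m].

Lemma mem_submonomials m a : (a \in submonomials m) = msubset a m.
Proof.
rewrite in_fset_set; last exact: finite_submonomials.
by apply/idP/idP; rewrite inE.
Qed.

Lemma uniq_submonomials m : uniq (submonomials m).
Proof. exact: fset_uniq. Qed.

Lemma coefM_seq f g m : coef (fps_mul f g) m =
  \sum_(a <- submonomials m) coef f a * coef g (msetB m a).
Proof. by rewrite /= fsbig_finite //; exact: finite_submonomials. Qed.

Lemma fps_addA : associative fps_add.
Proof. by move=> f g h; apply: fpsP => m /=; rewrite addrA. Qed.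
Lemma fps_addC : commutative fps_add.
Proof. by move=> f g; apply: fpsP => m /=; rewrite addrC. Qed.
Lemma fps_add0 : left_id fps0 fps_add.
Proof. by move=> f; apply: fpsP => m /=; rewrite add0r. Qed.
Lemma fps_addN : left_inverse fps0 fps_opp fps_add.
Proof. by move=> f; apply: fpsP => m /=; rewrite addNr. Qed.

HB.instance Definition _ :=
  GRing.isZmodule.Build fps fps_addA fps_addC fps_add0 fps_addN.

Lemma fps_mulC : commutative fps_mul.
Proof.
move=> f g; apply: fpsP => m; rewrite !coefM_seq.
rewrite (perm_big [seq msetB m a | a <- submonomials m]) /=.
  rewrite big_map big_seq [RHS]big_seq; apply: eq_bigr => a.
  by rewrite mem_submonomials => am; rewrite msetBBK // mulrC.
have inj : {in submonomials m &, injective (fun a => msetB m a)}.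
  move=> a b; rewrite !mem_submonomials => am bm E.
  by rewrite -(msetBBK am) E msetBBK.
apply: uniq_perm; rewrite ?uniq_submonomials ?map_inj_in_uniq ?uniq_submonomials //.
move=> a; rewrite mem_submonomials; apply/idP/mapP => [am | [b bm ->]].
  by exists (msetB m a); rewrite ?mem_submonomials ?msubsetDl ?msetBBK.
exact: msubsetDl.
Qed.

Lemma fps_mulA : associative fps_mul.
Proof.
move=> f g h; apply: fpsP => m; rewrite !coefM_seq.
transitivity (\sum_(a <- submonomials m) \sum_(b <- submonomials m | msubset a b)
    coef f a * coef g (msetB b a) * coef h (msetB m b)).
  rewrite big_seq [RHS]big_seq; apply: eq_bigr => a.
  rewrite mem_submonomials => am; rewrite coefM_seq mulr_sumr -[RHS]big_filter.
  rewrite [RHS](perm_big [seq msetD a b | b <- submonomials (msetB m a)]) /=.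
    rewrite big_map; apply: eq_bigr => b _.
    by rewrite mulrA msetDKB msetBDA.
  apply: uniq_perm; rewrite ?filter_uniq ?uniq_submonomials //.
    rewrite map_inj_uniq ?uniq_submonomials //; exact: can_inj (msetDKB a).
  move=> b; rewrite mem_filter mem_submonomials.
  apply/andP/mapP => [[ab bm] | [c]].
    by exists (msetB b a); rewrite ?mem_submonomials ?msetSB ?msetBDKC.
  rewrite mem_submonomials => cm ->; split.
    by apply/msubsetP => x; rewrite msetE2 leq_addr.
  by rewrite -(msetBDKC am) msetDS.
rewrite (exchange_big_dep xpredT) //= big_seq [RHS]big_seq.
apply: eq_bigr => b; rewrite mem_submonomials => bm.
rewrite -[RHS]/(coef (fps_mul f g) b * _) coefM_seq mulr_suml -big_filter; apply: perm_big.
apply: uniq_perm; rewrite ?filter_uniq ?uniq_submonomials //.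
move=> a; rewrite mem_filter !mem_submonomials andb_idr // => ab.
exact: msubset_trans ab bm.
Qed.

Lemma fps_mul1 : left_id fps1 fps_mul.
Proof.
move=> f; apply: fpsP => m; rewrite coefM_seq.
rewrite (bigD1_seq mset0) ?uniq_submonomials ?mem_submonomials ?msub0set //=.
rewrite eqxx mul1r msetB0 big1 ?addr0 // => a /negbTE ->.
by rewrite mul0r.
Qed.

Lemma fps_mulDl : left_distributive fps_mul fps_add.
Proof.
move=> f g h; apply: fpsP => m.
rewrite -[RHS]/(coef (fps_mul f h) m + coef (fps_mul g h) m) !coefM_seq.
by rewrite -big_split /=; apply: eq_bigr => a _; rewrite mulrDl.
Qed.

Lemma fps_1neq0 : fps1 != 0.
Proof. by apply/eqP => /(congr1 (fun f => coef f mset0)); rewrite /= eqxx. Qed.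

HB.instance Definition _ := GRing.Zmodule_isComNzRing.Build fps
  fps_mulA fps_mulC fps_mul1 fps_mulDl fps_1neq0.

(* e_k: sum of the squarefree monomials of degree k *)
Definition elemsym (k : int) : fps :=
  Fps (fun m => (uniq m && ((size m)%:Z == k))%:R).

Lemma elemsym0 : elemsym 0 = 1.
Proof.
apply: fpsP => m /=; congr (nat_of_bool _)%:R.
rewrite -[RHS]size_mset_eq0 -[RHS]eqz_nat andb_idl // eqz_nat size_mset_eq0.
by move=> /eqP ->; rewrite enum_mset0.
Qed.

Lemma elemsym_neg k : k < 0 -> elemsym k = 0.
Proof.
move=> k0; apply: fpsP => m /=; case: eqP => [E|]; last by rewrite andbF.
by move: k0; rewrite -E.
Qed.

Definition is_partition (lam : seq nat) : Prop :=
  sorted geq lam /\ 0%N \notin lam.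

(* Semistandard tableaux given by their list of rows (English notation), with
   entries the indices of the variables. *)
Definition is_ssyt (lam : seq nat) (T : seq (seq nat)) : Prop :=
  [/\ shape T = lam,
      forall i, sorted leq (nth [::] T i) &
      forall i j, (j < size (nth [::] T i.+1))%N ->
        (nth 0 (nth [::] T i) j < nth 0 (nth [::] T i.+1) j)%N].

(* s_lam = sum over all T of x^T: the coefficient of a monomial m is the number
   of semistandard tableaux of shape lam and content m. *)
Definition schur (lam : seq nat) : fps :=
  Fps (fun m => \sum_(T \in [set T | is_ssyt lam T /\
                                     seq_mset (flatten T) = m]) (1 : int)).

(* A sum over \in with infinite support is 0 by convention; this lemma and
   finite_partition show that the sums used here are over finite sets. *)
Lemma finite_ssyt lam (m : monomial) :
  finite_set [set T | is_ssyt lam T /\ seq_mset (flatten T) = m].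
Proof.
apply: (@sub_finite_set _ _
  [set` [seq reshape lam w | w <- permutations m]]); last exact: finite_seq.
move=> T [[Tl _ _] Tm] /=; apply/mapP; exists (flatten T).
  rewrite mem_permutations -Tm perm_sym; exact: perm_eq_seq_mset.
by rewrite -Tl flattenK.
Qed.

Lemma schur_nil : schur [::] = 1.
Proof.
apply: fpsP => m /=.
have [-> | m0] := eqVneq m mset0.
  rewrite (_ : [set T | _] = [set [::]]) ?fsbig_set1 //.
  apply/seteqP; split=> [T /= [[]] | T /= ->]; first by case: T.
  split; first by split=> // i; rewrite ?nth_nil // => j; rewrite nth_nil.
  by apply/msetP => x; rewrite mset_seqE mset0E.
rewrite (_ : [set T | _] = set0) ?fsbig_set0 //.
apply/seteqP; split=> // T /= [[]]; case: T => // _ _ _ E.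
case/eqP: m0; rewrite -E; by apply/msetP => x; rewrite mset_seqE mset0E.
Qed.

Lemma finite_partition n :
  finite_set [set lam | is_partition lam /\ sumn lam = n].
Proof.
pose F (p : 'I_n.+1 * n.-tuple 'I_n.+1) := take p.1 [seq val i | i <- p.2].
apply: (@sub_finite_set _ _ (F @` setT)); last first.
  exact: finite_image finite_finset.
move=> lam /= [[_ lam0] lamn].
have le_sum (s : seq nat) x : x \in s -> (x <= sumn s)%N.
  elim: s => //= y s IH; rewrite inE => /orP[/eqP -> | /IH]; first exact: leq_addr.
  by move=> h; apply: leq_trans h _; exact: leq_addl.
have le_size (s : seq nat) : 0%N \notin s -> (size s <= sumn s)%N.
  elim: s => //= y s IH; rewrite inE negb_or eq_sym -lt0n => /andP[y0 /IH].
  by move=> h; rewrite -add1n leq_add.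
have sl : (size lam <= n)%N by rewrite -lamn le_size.
pose t := [seq inord i : 'I_n.+1 | i <- lam ++ nseq (n - size lam) 0%N].
have st : size t == n by rewrite size_map size_cat size_nseq subnKC.
exists (inord (size lam), Tuple st) => //=.
rewrite /F /= inordK // /t -!map_take take_size_cat // -map_comp.
rewrite -[RHS]map_id; apply/eq_in_map => x xl /=.
by rewrite inordK // ltnS -lamn le_sum.
Qed.

(* (4^m4, 3^m3, 2^m2, 1^m1) *)
Definition part4321 (m4 m3 m2 m1 : nat) : seq nat :=
  (nseq m4 4 ++ nseq m3 3 ++ nseq m2 2 ++ nseq m1 1)%N.

(* Main.v *)
Require Import Defs.
From HB Require Import structures.
From mathcomp Require Import all_boot all_algebra perm finmap multiset.
From mathcomp Require Import boolp classical_sets cardinality fsbigop.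
From mathcomp Require Import ring zify.
Set Implicit Arguments.
Unset Strict Implicit.
Unset Printing Implicit Defensive.
Import GRing.Theory.

Local Open Scope classical_set_scope.
Local Open Scope ring_scope.

(** Why the identity holds.

    A partition with parts at most 4 is the conjugate of a partition
    mu_0 >= mu_1 >= mu_2 >= mu_3, and its parts 3, 2, 1 occur an even number
    of times exactly when the four mu_i have the same parity.  Put
    (a, b, c, d) = (mu_0 + 3, mu_1 + 2, mu_2 + 1, mu_3): these are decreasing
    naturals of alternating parity ([dec4], [alt4]) with sum 2r + 4.  By the
    dual Jacobi-Trudi formula ([dual_jacobi_trudi]) the right-hand side is the
    sum of the minors on the rows a, b, c, d of the matrix with four columns
    and entries M a j = e_(a - 3 + j).

    Such a sum is evaluated by minor summation.  Consider all the minors with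
    a > b and c > d, where a + b and c + d are odd.  Merging the two chains
    a > b and c > d into one decreasing sequence reorders the rows in one of
    six ways, with a sign, and the parity conditions are such that the signs
    add up to 4 for alternating parities and to 0 otherwise
    ([sum_interleave]).  On the other hand the Laplace expansion along the
    first two rows separates (a, b) from (c, d), so the same sum is a
    combination of products of sums of 2x2 minors ([sum_minor4_pairs]).  The
    sum of the 2x2 minors on columns i < j over a + b = 2p + 1, a > b,
    telescopes to j - i products of two e's ([sum_minor2]): e_m e_m for
    j = i + 1, then 2 e_m e_(m+1) for j = i + 2, and
    2 e_(m-1) e_(m+1) + e_m e_m for the outer columns.  Collecting terms
    gives four times the left-hand side.

    The dual Jacobi-Trudi formula is proved by induction on the number n of
    variables, [truncvar n] being the specialization that kills the variables
    from x_n on.  Both sides obey the same branching rule.  For tableaux: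
    erasing the entries n from a tableau with entries at most n leaves a
    tableau whose shape lacks at most one cell in each column
    ([schur_truncvarS]).  For determinants:
    e_k(x_0..x_n) = e_k(x_0..x_(n-1)) + x_n e_(k-1)(x_0..x_(n-1)), so
    expanding every row decreases the indices of any set of rows, and the sets
    that do not correspond to a smaller partition contribute a determinant
    with two equal rows or a zero row ([jt_add_var]). *)

(** * Specialization to finitely many variables *)

(** The specialization x_n = x_(n+1) = ... = 0, as an endomorphism of the ring of
    power series. *)
Definition truncvar n f :=
  Fps (fun m : monomial => if all (gtn n) m then coef f m else 0).

Lemma all_ltn_mset n (m : monomial) :
  reflect (forall i, (n <= i)%N -> m i = 0%N) (all (gtn n) m).
Proof.
apply: (iffP allP) => [H i ni | H i]; first last.
  by rewrite in_mset /=; case: (leqP n i) => // /H ->.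
by apply/mset_eq0P; apply/negP => /H /=; rewrite ltnNge ni.
Qed.

Lemma truncvar_is_zmod_morphism n : zmod_morphism (truncvar n).
Proof. by move=> f g; apply: fpsP => m /=; case: ifP => // _; rewrite subr0. Qed.

(** A product of monomials involves no variable from x_n on exactly when
    neither factor does. *)
Lemma truncvar_is_monoid_morphism n : monoid_morphism (truncvar n).
Proof.
split=> [|f g]; apply: fpsP => m.
  rewrite /=; case: eqP => [-> | _]; last by rewrite if_same.
  by rewrite enum_mset0.
rewrite -[RHS]/(coef (fps_mul _ _) _) coefM_seq.
rewrite -[LHS]/(if _ then coef (fps_mul f g) m else 0) coefM_seq.
have [mn|mn] := boolP (all _ _).
  rewrite big_seq [RHS]big_seq; apply: eq_bigr => a.
  rewrite mem_submonomials => am /=.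
  have sub (b : monomial) : msubset b m -> all (gtn n) b.
    move=> /msubset_subset bm; apply/allP => x /bm; exact: (allP mn).
  by rewrite !sub // msubsetDl.
rewrite big_seq big1 // => a; rewrite mem_submonomials => /msubsetP am /=.
have [an|] := boolP (all _ (a : monomial)); last by rewrite mul0r.
have [bn|] := boolP (all _ (msetB m a : monomial)); last by rewrite mulr0.
case/negP: mn; apply/all_ltn_mset => i ni.
move/all_ltn_mset: an => /(_ i ni); move/all_ltn_mset: bn => /(_ i ni).
by rewrite msetE2; lia.
Qed.

HB.instance Definition _ n :=
  GRing.isZmodMorphism.Build fps fps (truncvar n) (truncvar_is_zmod_morphism n).
HB.instance Definition _ n :=
  GRing.isMonoidMorphism.Build fps fps (truncvar n)
    (truncvar_is_monoid_morphism n).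

(** A monomial involves finitely many variables, so it survives some
    specialization. *)
Lemma truncvar_inj f g : (forall n, truncvar n f = truncvar n g) -> f = g.
Proof.
move=> fg; apply: fpsP => m; pose n := (\max_(i <- m) i).+1.
have mn : all (gtn n) m.
  by apply/allP => i im /=; rewrite ltnS (@leq_bigmax_seq _ _ xpredT id).
by move: (fg n) => /(congr1 (fun h => coef h m)) /=; rewrite mn.
Qed.

Definition var n := Fps (fun m => (m == [mset n]%mset)%:R).

Lemma coef_varM n f (m : monomial) :
  coef (var n * f) m = if n \in m then coef f (m `\ n)%mset else 0.
Proof.
rewrite -[LHS]/(coef (fps_mul _ _) _) coefM_seq; case: ifP => nm.
  rewrite (bigD1_seq [mset n]%mset) ?uniq_submonomials ?mem_submonomials
          ?msub1set //= eqxx mul1r big1 ?addr0 // => a /negbTE ->.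
  by rewrite mul0r.
rewrite big_seq big1 // => a; rewrite mem_submonomials => am /=.
case: eqP => [aE|]; last by rewrite mul0r.
by move: am; rewrite aE msub1set nm.
Qed.

Lemma coef_varXM n c f (m : monomial) :
  coef (var n ^+ c * f) m =
  if (c <= m n)%N then coef f (msetB m (msetn c n)) else 0.
Proof.
elim: c m => [|c IH] m; first by rewrite expr0 mul1r msetn0 msetB0.
rewrite exprS -mulrA coef_varM in_mset IH msetB1E eqxx.
case: (posnP (m n)) => [-> //|m0].
rewrite (_ : (c <= m n - 1)%N = (c < m n)%N); last by lia.
case: ifP => // _; congr (coef f _); apply/msetP => i.
by rewrite !msetE2 !msetnE; case: (i == n) => /=; lia.
Qed.

Lemma uniq_mset (m : monomial) : reflect (forall i, (m i <= 1)%N) (uniq m).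
Proof.
apply: (iffP idP) => [um i | H]; first by rewrite -count_mem_mset count_uniq_mem ?leq_b1.
apply: count_mem_uniq => i; rewrite count_mem_mset in_mset.
by case: (m i) (H i) => [|[]].
Qed.

Lemma size_msetB1 n (m : monomial) : n \in m -> size m = (size (m `\ n)%mset).+1.
Proof.
move=> nm.
rewrite -{1}(msetB1K nm) -{1}[(m `\ n)%mset]seq_mset_id -mset_cons.
by rewrite (perm_size (perm_eq_seq_mset _)).
Qed.

(** A squarefree monomial in x_0..x_n contains x_n at most once. *)
Lemma truncvar_elemsymS n k :
  truncvar n.+1 (elemsym k) =
  truncvar n (elemsym k) + var n * truncvar n (elemsym (k - 1)).
Proof.
apply: fpsP => m.
rewrite -[RHS]/(coef _ _ + coef (var n * _) _) coef_varM /=.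
have [nm|nm] := boolP (n \in m); last first.
  rewrite addr0 (_ : all (gtn n.+1) m = all (gtn n) m) //.
  apply: eq_in_all => i im /=; rewrite ltnS leq_eqVlt.
  by case: eqP => // iE; rewrite -iE im in nm.
rewrite (_ : all (gtn n) m = false) ?add0r; last first.
  by apply/negP => /allP /(_ n nm) /=; rewrite ltnn.
have [/uniq_mset um|um] := boolP (uniq m); last first.
  rewrite if_same; case: ifP => // /all_ltn_mset mn.
  have [/uniq_mset um'|] := boolP (uniq (m `\ n)%mset); last by [].
  case/negP: um; apply/uniq_mset => i.
  have := um' i; have := mn n (leqnn n); rewrite !msetB1E eqxx.
  by have [->|_] := eqVneq i n; lia.
rewrite (_ : all (gtn n.+1) m = all (gtn n) (m `\ n)%mset); last first.
  apply/all_ltn_mset/all_ltn_mset => H i; rewrite ?msetB1E.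
    have [->|/eqP] := eqVneq i n => ni; first by have := um n; lia.
    by move=> ?; have := H i; lia.
  by move=> ni; have := H i; rewrite msetB1E; lia.
rewrite (_ : uniq _ = true); last first.
  by apply/uniq_mset => i; rewrite msetB1E; have := um i; lia.
rewrite (size_msetB1 nm) !andTb; case: ifP => // _; congr (nat_of_bool _)%:R.
by move: (size _) => x; apply/eqP/eqP; lia.
Qed.

Lemma truncvar0_elemsym k : truncvar 0 (elemsym k) = (k == 0)%:R.
Proof.
have -> : ((k == 0)%:R : fps) = truncvar 0 (k == 0)%:R.
  by case: (k == 0); rewrite ?rmorph1 ?rmorph0.
apply: fpsP => m /=; case: ifP => // /all_ltn_mset m0.
have -> : m = mset0 by apply/msetP => i; rewrite mset0E m0.
have -> : coef (k == 0)%:R mset0 = (k == 0)%:R.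
  by case: (k == 0) => //=; rewrite eqxx.
by rewrite enum_mset0 /= eq_sym.
Qed.

(** * Determinants of Jacobi-Trudi type *)

(** Extending by [false] makes the column that follows the last one
    available, so that the last column needs no special treatment below. *)
Definition ext k (e : {ffun 'I_k -> bool}) (i : nat) : bool :=
  if insub i is Some j then e j else false.

Lemma ext_ord k (e : {ffun 'I_k -> bool}) (i : 'I_k) : ext e i = e i.
Proof. by rewrite /ext valK. Qed.

Lemma ext_ge k (e : {ffun 'I_k -> bool}) i : (k <= i)%N -> ext e i = false.
Proof. by move=> ki; rewrite /ext insubF // ltnNge ki. Qed.

Section JTDet.
Variable R : comNzRingType.
Implicit Types (h : int -> R) (a : nat -> int).

(** The Jacobi-Trudi determinant in terms of the index [a i] found in column 0
    of row [i]; these indices may be negative, so that decreasing an index by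
    one is always possible. *)
Definition jtdet h k a : R := \det (\matrix_(i < k, j < k) h (a i + j%:Z)).

(** Row-multilinearity: each row is the sum of two rows, so the determinant is
    a sum over the choices [e] of one of them in each row. *)
Lemma jtdet_add_var h h' x k a : (forall l, h l = h' l + x * h' (l - 1)) ->
  jtdet h k a = \sum_(e : {ffun 'I_k -> bool}) x ^+ (\sum_i e i) *
                  jtdet h' k (fun i => a i - (ext e i)%:Z).
Proof.
move=> hE; rewrite /jtdet /determinant.
transitivity (\sum_(s : 'S_k) \sum_(e : {ffun 'I_k -> bool}) x ^+ (\sum_i e i) *
    ((-1) ^+ s * \prod_(i < k) h' (a i - (e i)%:Z + (s i)%:Z))).
  apply: eq_bigr => s _.
  transitivity ((-1) ^+ s * \prod_(i < k) \sum_(b : bool)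
      x ^+ b * h' (a i - b%:Z + (s i)%:Z)).
    congr (_ * _); apply: eq_bigr => i _; rewrite !mxE big_bool hE addrC /=.
    by rewrite expr1 expr0 mul1r subr0 addrAC.
  rewrite bigA_distr_bigA mulr_sumr; apply: eq_bigr => e _.
  by rewrite big_split /= -expr_sum mulrCA.
rewrite exchange_big; apply: eq_bigr => e _; rewrite -mulr_sumr; congr (_ * _).
apply: eq_bigr => s _; congr (_ * _).
by apply: eq_bigr => i _; rewrite !mxE ext_ord.
Qed.

Lemma jtdet_eq_rows h k a i j :
  (i < j < k)%N -> a i = a j -> jtdet h k a = 0.
Proof.
move=> /andP[ij jk] aij.
apply: (determinant_alternate (i1 := Ordinal (ltn_trans ij jk))
                              (i2 := Ordinal jk)) => [|l].
  by rewrite -val_eqE /= neq_ltn ij.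
by rewrite !mxE aij.
Qed.

(** All the indices in the row are negative. *)
Lemma jtdet_neg_row h k a i : (forall l, l < 0 -> h l = 0) ->
  (i < k)%N -> a i + k%:Z <= 0 -> jtdet h k a = 0.
Proof.
move=> h0 ik ai; rewrite /jtdet (expand_det_row _ (Ordinal ik)) big1 // => j _.
by rewrite mxE h0 ?mul0r //=; have := ltn_ord j; lia.
Qed.

End JTDet.

Lemma rmorph_jtdet (R S : comNzRingType) (f : {rmorphism R -> S}) h k a :
  f (jtdet h k a) = jtdet (f \o h) k a.
Proof.
by rewrite /jtdet -det_map_mx; congr (\det _); apply/matrixP => i j; rewrite !mxE.
Qed.

(** If [mu] lists column lengths, [shrink mu e] shortens by one the columns
    selected by [e].  The condition says that among columns of equal length the
    selected ones come last, which is what keeps the lengths decreasing.  As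
    [ext e] is false beyond [k], it also prevents the selection of an empty
    column. *)
Definition vstrip k (mu : nat -> nat) (e : {ffun 'I_k -> bool}) :=
  [forall i : 'I_k, e i && (mu i.+1 == mu i) ==> ext e i.+1].

Definition shrink k (mu : nat -> nat) (e : {ffun 'I_k -> bool}) i :=
  (mu i - ext e i)%N.

(** A partition with at most [k] parts, as a function on all naturals so that
    comparing the parts [i] and [i.+1] makes sense for the last one too. *)
Definition is_part k (mu : nat -> nat) :=
  {homo mu : i j / (i <= j)%N >-> (j <= i)%N} /\
  forall i, (k <= i)%N -> mu i = 0%N.

(** A selected empty column would force the next column, which is empty too, to
    be selected, and so on beyond column [k]. *)
Lemma vstrip_le k mu (e : {ffun 'I_k -> bool}) i :
  is_part k mu -> vstrip mu e -> (ext e i <= mu i)%N.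
Proof.
move=> [mon mu0] /forallP st.
have H d j : (i <= j)%N -> (k <= j + d)%N -> (ext e j <= mu j)%N.
  elim: d j => [|d IH] j ij; first by rewrite addn0 => /ext_ge ->.
  have [kj|kj kd] := leqP k j; first by rewrite ext_ge.
  move: (st (Ordinal kj)); rewrite -ext_ord /=; case: (ext e j) => //=.
  by have := IH j.+1; have := mon j j.+1 (leqnSn j); case: (ext e j.+1); lia.
by apply: (H k) => //; apply: leq_addl.
Qed.

Lemma shrink_part k mu (e : {ffun 'I_k -> bool}) :
  is_part k mu -> vstrip mu e -> is_part k (shrink mu e).
Proof.
move=> pmu st; have [mon mu0] := pmu; split; last first.
  by move=> i /mu0; rewrite /shrink => ->.
have mon' j : (shrink mu e j.+1 <= shrink mu e j)%N.
  rewrite /shrink; have := mon j j.+1 (leqnSn j).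
  have := vstrip_le j pmu st; have := vstrip_le j.+1 pmu st.
  have [kj|kj] := leqP k j; first by rewrite !ext_ge; lia.
  move/forallP: st => /(_ (Ordinal kj)); rewrite -ext_ord /=.
  by case: (ext e j); case: (ext e j.+1) => //=; lia.
move=> i j /subnK <-; elim: (j - i)%N => // d IH.
exact: leq_trans (mon' _) IH.
Qed.

Section JT.
Variable R : comNzRingType.
Implicit Types h : int -> R.

Definition jt h k (mu : nat -> nat) := jtdet h k (fun i => (mu i)%:Z - i%:Z).

(** If a selected row [i] is followed by an unselected one of the same length,
    then decreasing the indices makes the two rows equal; for the last row of
    length 0, it makes all the indices negative.  So only vertical strips
    contribute to the expansion over choices of rows. *)
Lemma jt_add_var h h' x k mu :
  (forall l, l < 0 -> h' l = 0) -> (forall l, h l = h' l + x * h' (l - 1)) ->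
  is_part k mu ->
  jt h k mu = \sum_(e : {ffun 'I_k -> bool} | vstrip mu e)
                x ^+ (\sum_i e i) * jt h' k (shrink mu e).
Proof.
move=> h0 hE pmu; rewrite /jt (jtdet_add_var _ _ hE) (bigID (vstrip mu)) /=.
rewrite [X in _ + X]big1 ?addr0 => [|e]; last first.
  rewrite negb_forall => /existsP[i]; rewrite negb_imply -andbA => /and3P[ei].
  move=> /eqP mui ei1.
  rewrite (_ : jtdet _ _ _ = 0) ?mulr0 //.
  have [ik|ik] := ltnP i.+1 k; last first.
    have mui0 : mu i = 0%N by rewrite -mui; case: pmu => _ ->.
    by apply: (jtdet_neg_row h0 (ltn_ord i)); rewrite mui0 ext_ord ei; lia.
  apply: (@jtdet_eq_rows _ _ _ _ i i.+1); first by rewrite ltnSn.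
  by rewrite mui ext_ord ei (negbTE ei1); lia.
apply: eq_bigr => e st; congr (_ * _).
rewrite /jtdet; congr (\det _); apply/matrixP => i j; rewrite !mxE.
by congr (h' _); have := vstrip_le i pmu st; rewrite /shrink; lia.
Qed.

(** The case of no variables, where the generating series of [h] is 1: row 0
    vanishes unless [mu] is empty, and then the matrix is the identity. *)
Lemma jt_delta h k mu : (forall l, h l = (l == 0)%:R) -> is_part k mu ->
  jt h k mu = (mu 0%N == 0%N)%:R.
Proof.
move=> hE [mon mu0]; rewrite /jt /jtdet.
have [m0|m0] := posnP (mu 0%N).
  rewrite (_ : \matrix_(i, j) _ = 1%:M) ?det1 //; apply/matrixP => i j.
  rewrite !mxE hE (_ : mu i = 0%N); last first.
    by apply/eqP; rewrite -leqn0 -m0 mon.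
  by congr (nat_of_bool _)%:R; rewrite -val_eqE /=; lia.
have k0 : (0 < k)%N by rewrite lt0n; apply/eqP => k0; move: m0; rewrite mu0 ?k0.
rewrite (expand_det_row _ (Ordinal k0)) big1 // => j _.
rewrite !mxE hE /= (_ : _ == 0 = false) ?mul0r //; lia.
Qed.

End JT.

(** * Conjugate partitions *)

(** The conjugate of [mu], padded with zeros to length [L].  A fixed length
    avoids discarding rows that become empty when entries are erased from a
    tableau. *)
Definition conjpart k L (mu : nat -> nat) : seq nat :=
  mkseq (fun i => (\sum_(j < k) (i < mu j))%N) L.

Lemma lt_sum_antitone k (f : nat -> bool) j :
  (forall i l, (i <= l)%N -> f l -> f i) -> (forall i, (k <= i)%N -> ~~ f i) ->
  (j < \sum_(l < k) f l)%N = f j.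
Proof.
move=> anti f0; have [fj|fj] := boolP (f j).
  have jk : (j < k)%N by rewrite ltnNge; apply/negP => /f0; rewrite fj.
  rewrite -(big_mkord xpredT (fun l => f l : nat)) (big_cat_nat _ (n := j.+1)) //=.
  apply: leq_trans (leq_addr _ _).
  rewrite (eq_big_nat _ _ (F2 := fun=> 1%N)) ?sum_nat_const_nat; first by lia.
  by move=> i /andP[_ ij]; rewrite (anti i j).
apply/negbTE; rewrite -leqNgt.
have [kj|jk] := leqP k j.
  apply: leq_trans kj; rewrite -[X in (_ <= X)%N]card_ord -sum1_card.
  by apply: leq_sum => i _; case: (f i).
rewrite -(big_mkord xpredT (fun l => f l : nat)) (big_cat_nat _ (n := j)) //=; last exact: ltnW.
rewrite [X in (_ + X)%N]big_nat [X in (_ + X)%N]big1 ?addn0; last first.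
  move=> i /andP[ji _]; apply/eqP; rewrite eqb0.
  by apply: contra fj; exact: anti.
rewrite -[X in (_ <= X)%N]subn0 -[X in (_ <= X)%N]muln1 -sum_nat_const_nat.
by apply: leq_sum => i _; case: (f i).
Qed.

Lemma size_conjpart k L mu : size (conjpart k L mu) = L.
Proof. by rewrite size_mkseq. Qed.

(** Both sides say that the cell in row [i] and column [j] lies in the diagram.
    All the comparisons between [mu] and its conjugate go through this. *)
Lemma lt_conjpart k L mu i j : is_part k mu -> (mu 0%N <= L)%N ->
  (j < nth 0 (conjpart k L mu) i)%N = (i < mu j)%N.
Proof.
move=> [mon mu0] muL; have [iL|Li] := ltnP i L.
  rewrite nth_mkseq // (@lt_sum_antitone k (fun j => i < mu j)%N) //.
    by move=> a b ab iL'; apply: leq_trans (mon _ _ ab).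
  by move=> a /mu0 ->.
rewrite nth_default ?size_conjpart // ltn0; apply/esym/negbTE.
by have := mon 0%N j (leq0n j); lia.
Qed.

Lemma eq_from_ltn m n : (forall i, (i < m) = (i < n))%N -> m = n.
Proof. by move=> H; have := H m; have := H n; lia. Qed.

Lemma conjpartP k L mu s : is_part k mu -> (mu 0%N <= L)%N -> size s = L ->
  (forall i j, (j < nth 0 s i)%N = (i < mu j)%N) -> s = conjpart k L mu.
Proof.
move=> pmu muL sL H; apply: (@eq_from_nth _ 0%N) => [|i _].
  by rewrite size_conjpart.
by apply: eq_from_ltn => j; rewrite H lt_conjpart.
Qed.

Lemma sumn_conjpart k L mu : is_part k mu -> (mu 0%N <= L)%N ->
  sumn (conjpart k L mu) = (\sum_(j < k) mu j)%N.
Proof.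
move=> [mon mu0] muL; rewrite sumnE big_map -[X in iota _ X]subn0 -/(index_iota 0 L).
rewrite exchange_big /=; apply: eq_bigr => j _; rewrite big_mkord.
apply: eq_from_ltn => i; rewrite (@lt_sum_antitone L (fun i => i < mu j)%N) //.
  by move=> a b; lia.
by move=> a; have := mon 0%N j (leq0n j); lia.
Qed.

(** * The branching rule for tableaux *)

(** Erasing the entries at least [n]; on tableaux with entries at most [n] its
    inverse is [fill], which pads every row with [n] up to the shape [lam]. *)
Definition strip n (T : seq (seq nat)) := [seq [seq x <- s | (x < n)%N] | s <- T].

Definition fill n (lam : seq nat) (T : seq (seq nat)) :=
  mkseq (fun i => nth [::] T i ++
           nseq (nth 0%N lam i - size (nth [::] T i)) n) (size lam).

Lemma nth_strip n T i : nth [::] (strip n T) i = [seq x <- nth [::] T i | (x < n)%N].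
Proof.
have [iT|Ti] := ltnP i (size T); first by rewrite (nth_map [::]).
by rewrite !nth_default ?size_map.
Qed.

Lemma filter_sorted_cat n s : sorted leq s -> all (gtn n.+1) s ->
  s = [seq x <- s | (x < n)%N] ++ nseq (size s - size [seq x <- s | (x < n)%N]) n.
Proof.
elim: s => //= x s IH xs /andP[xn sn].
have [xn'|nx] := ltnP x n; first by rewrite /= subSS -IH // (path_sorted xs).
have xE : x = n by move: xn => /=; lia.
have sE y : y \in s -> y = n.
  move=> ys; move: (allP sn _ ys) => /=.
  have /allP/(_ _ ys) := order_path_min leq_trans xs; rewrite xE; lia.
rewrite (_ : filter _ s = [::]); last first.
  rewrite (eq_in_filter (a2 := pred0)) ?filter_pred0 // => y /sE -> .
  by rewrite ltnn.
rewrite subn0 /= xE; congr (_ :: _); apply/all_pred1P/allP => y /sE -> /=.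
by rewrite eqxx.
Qed.

Lemma nth_shape T i : nth 0%N (shape T) i = size (nth [::] T i : seq nat).
Proof.
have [iT|Ti] := ltnP i (size T); first by rewrite (nth_map [::]).
by rewrite !nth_default ?size_map.
Qed.

Lemma all_nth_flatten n T i : all (gtn n) (flatten T) -> all (gtn n) (nth [::] T i).
Proof.
have [iT|Ti] := ltnP i (size T); last by rewrite nth_default.
move=> /allP Tn; apply/allP => x xi; apply: Tn; apply/flattenP.
by exists (nth [::] T i) => //; exact: mem_nth.
Qed.

Section Strip.
Variables (n : nat) (lam : seq nat) (T : seq (seq nat)).
Hypotheses (ssT : is_ssyt lam T) (Tn : all (gtn n.+1) (flatten T)).
Hypothesis lam_part : forall i, (nth 0 lam i.+1 <= nth 0 lam i)%N.

Let sizeT i : size (nth [::] T i) = nth 0%N lam i.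
Proof. by case: ssT => <- _ _; rewrite nth_shape. Qed.

Lemma strip_row_cat i : nth [::] T i =
  nth [::] (strip n T) i ++ nseq (nth 0%N lam i - size (nth [::] (strip n T) i)) n.
Proof.
rewrite nth_strip -sizeT; apply: filter_sorted_cat; last exact: all_nth_flatten.
by case: ssT.
Qed.

Lemma size_strip_row i : (size (nth [::] (strip n T) i) <= nth 0%N lam i)%N.
Proof. by rewrite nth_strip -sizeT size_filter count_size. Qed.

Lemma nth_strip_row i j : (j < size (nth [::] (strip n T) i))%N ->
  nth 0%N (nth [::] (strip n T) i) j = nth 0%N (nth [::] T i) j.
Proof. by move=> ji; rewrite [in RHS]strip_row_cat nth_cat ji. Qed.

(** A cell of row [i.+1] has an entry at most [n], so the entry above it is less
    than [n] and is not erased. *)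
Lemma strip_interlace i : (nth 0%N lam i.+1 <= size (nth [::] (strip n T) i))%N.
Proof.
rewrite leqNgt; apply/negP => ij; set j := size _ in ij.
have ji : (j < size (nth [::] T i.+1))%N by rewrite sizeT.
have jl := leq_trans ij (lam_part i).
case: ssT => _ _ /(_ _ _ ji).
have : (nth 0%N (nth [::] T i.+1) j <= n)%N.
  by have /allP/(_ _ (mem_nth 0%N ji)) := all_nth_flatten i.+1 Tn.
by rewrite [nth [::] T i]strip_row_cat nth_cat ltnn nth_nseq subnn subn_gt0 jl; lia.
Qed.

Lemma strip_ssyt : is_ssyt (shape (strip n T)) (strip n T).
Proof.
split=> // [i | i j ji].
  by rewrite nth_strip sorted_filter //; [exact: leq_trans | case: ssT].
have ji' : (j < size (nth [::] T i.+1))%N.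
  by rewrite sizeT; exact: leq_trans (size_strip_row _).
rewrite !nth_strip_row //; first by case: ssT => _ _; apply.
by apply: leq_trans (strip_interlace _); rewrite -sizeT.
Qed.

Lemma fill_strip : fill n lam (strip n T) = T.
Proof.
have sT : size lam = size T by case: ssT => <- _ _; rewrite size_map.
apply: (@eq_from_nth _ [::]) => [|i]; rewrite size_mkseq sT // => iT.
by rewrite nth_mkseq ?sT // [RHS]strip_row_cat.
Qed.

End Strip.

Section Fill.
Variables (n : nat) (lam lam' : seq nat) (T : seq (seq nat)).
Hypotheses (ssT : is_ssyt lam' T) (Tn : all (gtn n) (flatten T)).
Hypothesis lam_lam' : forall i, (nth 0 lam' i <= nth 0 lam i)%N.
Hypothesis interlace : forall i, (nth 0 lam i.+1 <= nth 0 lam' i)%N.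
Hypothesis size_lam' : size lam' = size lam.

Let sizeT i : size (nth [::] T i) = nth 0%N lam' i.
Proof. by case: ssT => <- _ _; rewrite nth_shape. Qed.

Lemma nth_fill i : nth [::] (fill n lam T) i =
  nth [::] T i ++ nseq (nth 0 lam i - nth 0 lam' i)%N n.
Proof.
have [il|li] := ltnP i (size lam); first by rewrite nth_mkseq // sizeT.
rewrite [LHS]nth_default ?size_mkseq // [nth 0%N lam i]nth_default //.
by rewrite nth_default // -(size_map size) -/(shape _); case: ssT => -> *; rewrite size_lam'.
Qed.

(** The added entries [n] form a horizontal strip: by [interlace], the cell above
    any cell of the new shape belongs to the old one. *)
Lemma fill_ssyt : is_ssyt lam (fill n lam T).
Proof.
have lt_n i j : (j < nth 0 lam' i)%N -> (nth 0%N (nth [::] T i) j < n)%N.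
  rewrite -sizeT => ji.
  by have /allP/(_ _ (mem_nth 0%N ji)) := all_nth_flatten i Tn.
split=> [|i|i j].
- apply: (@eq_from_nth _ 0%N) => [|i _]; first by rewrite size_map size_mkseq.
  by rewrite nth_shape nth_fill size_cat size_nseq sizeT subnKC.
- rewrite nth_fill; case: ssT => _ /(_ i) srt _.
  have /allP lt_n' := all_nth_flatten i Tn.
  elim: (nth [::] T i) srt lt_n' => [_ _ | x s IH /= srt lt_n'] /=.
    by case: (_ - _)%N => //= d; elim: d => //= d ->; rewrite leqnn.
  rewrite path_min_sorted ?IH ?(path_sorted srt) //.
    by move=> y ys; apply: lt_n'; rewrite inE ys orbT.
  rewrite all_cat (order_path_min leq_trans srt) /=; apply/allP => y.
  by rewrite mem_nseq => /andP[_ /eqP ->]; apply: ltnW; apply: lt_n'; rewrite inE eqxx.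
rewrite !nth_fill size_cat size_nseq sizeT subnKC // => jl.
have ji := leq_trans jl (interlace i).
rewrite !nth_cat !sizeT ji; case: ifP => ji1.
  by case: ssT => _ _; apply; rewrite sizeT.
by rewrite nth_nseq ltn_sub2r ?lt_n //; lia.
Qed.

Lemma strip_fill : strip n (fill n lam T) = T.
Proof.
have sT : size T = size lam by case: ssT size_lam' => <- _ _; rewrite size_map.
apply: (@eq_from_nth _ [::]) => [|i _]; first by rewrite size_map size_mkseq.
rewrite nth_strip nth_fill filter_cat; have /all_filterP -> := all_nth_flatten i Tn.
rewrite (eq_in_filter (a2 := pred0)) ?filter_pred0 ?cats0 // => x.
by rewrite mem_nseq => /andP[_ /eqP ->]; rewrite ltnn.
Qed.

End Fill.

Lemma flatten_strip n T : flatten (strip n T) = [seq x <- flatten T | (x < n)%N].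
Proof. by elim: T => //= s T ->; rewrite filter_cat. Qed.

Lemma count_fill n lam T x : size T = size lam ->
  (forall i, (size (nth [::] T i) <= nth 0 lam i)%N) ->
  count_mem x (flatten (fill n lam T)) =
  (count_mem x (flatten T) + (x == n) * (sumn lam - sumn (shape T)))%N.
Proof.
elim: T lam => [|s T IH] [|l lam] //=; first by rewrite muln0.
move=> [sT] le_T; have le_s := le_T 0%N; have le_T' i := le_T i.+1.
have le_sumn : (sumn (shape T) <= sumn lam)%N.
  elim: T lam sT le_T' {IH le_T le_s} => [|t T IH] [|k lam] //= [sT] le_T.
  by apply: leq_add; [exact: (le_T 0%N) | apply: IH => // i; exact: (le_T i.+1)].
rewrite /fill /mkseq /= -[1%N]addn0 iotaDl -map_comp /= !count_cat count_nseq.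
rewrite -[X in flatten X]/(fill n lam T) IH //= eq_sym.
by case: (x == n); move: le_s => /=; lia.
Qed.

Lemma sumn_shape_strip n T : all (gtn n.+1) (flatten T) ->
  sumn (shape T) = (sumn (shape (strip n T)) + count_mem n (flatten T))%N.
Proof.
move=> /allP Tn; rewrite -!size_flatten flatten_strip size_filter.
rewrite -(count_predC (fun x => x < n)%N (flatten T)); congr (_ + _)%N.
by apply: eq_in_count => x /Tn /=; rewrite ltnS -leqNgt eqn_leq => ->.
Qed.

Section Branching.
Variables (n k L : nat) (mu : nat -> nat).
Hypotheses (pmu : is_part k mu) (muL : (mu 0%N <= L)%N).
Let lam := conjpart k L mu.
Implicit Types (e : {ffun 'I_k -> bool}) (T : seq (seq nat)) (m : monomial).

Let lam' e := conjpart k L (shrink mu e).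

Let shrinkL e : (shrink mu e 0%N <= L)%N.
Proof. by apply: leq_trans muL; rewrite leq_subr. Qed.

Let lt_lam i j : (j < nth 0 lam i)%N = (i < mu j)%N.
Proof. exact: lt_conjpart. Qed.

Let lt_lam' e i j : vstrip mu e ->
  (j < nth 0 (lam' e) i)%N = (i < mu j - ext e j)%N.
Proof. by move=> st; rewrite lt_conjpart //; exact: shrink_part. Qed.

Let lam_part i : (nth 0 lam i.+1 <= nth 0 lam i)%N.
Proof.
case E: (nth 0%N lam i.+1) => [//|j].
have : (j < nth 0 lam i.+1)%N by rewrite E.
by rewrite !lt_lam; apply: ltn_trans.
Qed.

(** The selection [e] consists of the columns whose bottom cell, in row
    [(mu j).-1], contains [n]; the proof checks that the rows of the stripped
    tableau are those of the diagram with these cells removed. *)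
Lemma shape_strip T : is_ssyt lam T -> all (gtn n.+1) (flatten T) ->
  exists2 e : {ffun 'I_k -> bool}, vstrip mu e & shape (strip n T) = lam' e.
Proof.
move=> ssT Tn; have [mon mu0] := pmu.
set s := shape (strip n T).
have sE i : nth 0%N s i = size (nth [::] (strip n T) i) by rewrite nth_shape.
have s_le i : (nth 0%N s i <= nth 0%N lam i)%N by rewrite sE (size_strip_row n ssT).
have s_ge i : (nth 0%N lam i.+1 <= nth 0%N s i)%N.
  by rewrite sE (strip_interlace ssT).
have s_anti i d : (nth 0%N s (d + i) <= nth 0%N s i)%N.
  elim: d => // d IH; apply: leq_trans IH; rewrite addSn.
  exact: leq_trans (s_le _) (s_ge _).
pose e := [ffun j : 'I_k => (0 < mu j)%N && (nth 0 s (mu j).-1 <= j)%N].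
have extE j : ext e j = (0 < mu j)%N && (nth 0 s (mu j).-1 <= j)%N.
  have [jk|kj] := ltnP j k; first by rewrite (ext_ord e (Ordinal jk)) ffunE.
  by rewrite ext_ge // mu0.
have key i j : (j < nth 0 s i)%N = (i < mu j - ext e j)%N.
  rewrite extE; apply/idP/idP => [ji|].
    have imu : (i < mu j)%N by rewrite -lt_lam; exact: leq_trans (s_le i).
    case: (leqP (nth 0%N s (mu j).-1) j) => [sj|_]; last by rewrite andbF subn0.
    rewrite andbT (leq_ltn_trans _ imu) //.
    have : i != (mu j).-1 by apply: contraL ji => /eqP ->; rewrite -leqNgt.
    by move/eqP; move: imu; lia.
  case: (leqP (nth 0%N s (mu j).-1) j) => [sj|js]; rewrite ?andbF ?andbT.
    move=> H; have : (i.+1 < mu j)%N by move: H; case: (mu j) => [|[]] //=; lia.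
    by rewrite -lt_lam => H'; exact: leq_trans (s_ge i).
  rewrite subn0 => imu; apply: leq_trans js _.
  have -> : (mu j).-1 = ((mu j).-1 - i + i)%N by move: imu; lia.
  exact: s_anti.
have st : vstrip mu e.
  apply/forallP => i; apply/implyP => /andP[]; rewrite -ext_ord !extE => /andP[m0 si].
  by move=> /eqP ->; rewrite m0 (leq_trans si).
exists e => //; apply: conjpartP => //; first exact: shrink_part.
case: ssT => Tl _ _.
by rewrite !size_map -(size_map size T) -/(shape T) Tl size_conjpart.
Qed.

Lemma conj_shrink_inj e e' : vstrip mu e -> vstrip mu e' -> lam' e = lam' e' -> e = e'.
Proof.
move=> st st' E; apply/ffunP => j; rewrite -!ext_ord.
have : (mu j - ext e j = mu j - ext e' j)%N.
  by apply: eq_from_ltn => i; rewrite -!lt_lam' // E.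
have := vstrip_le j pmu st; have := vstrip_le j pmu st'.
by case: (ext e j); case: (ext e' j); lia.
Qed.

Lemma sumn_conj_shrink e : vstrip mu e -> sumn lam = (sumn (lam' e) + \sum_i e i)%N.
Proof.
move=> st; rewrite !sumn_conjpart //; last exact: shrink_part.
rewrite -big_split /=; apply: eq_bigr => j _.
by rewrite -ext_ord subnK // vstrip_le.
Qed.

Let tabs s m : set (seq (seq nat)) :=
  [set T | is_ssyt s T /\ seq_mset (flatten T) = m].

Lemma coef_schur s m : coef (schur s) m = (size (fset_set (tabs s m)))%:R.
Proof.
rewrite /= fsbig_finite; last exact: finite_ssyt.
by rewrite big_const_seq count_predT iter_addr addr0.
Qed.

Lemma mem_tabs s m T :
  reflect (is_ssyt s T /\ seq_mset (flatten T) = m) (T \in fset_set (tabs s m)).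
Proof. by rewrite in_fset_set ?inE; [exact: asboolP | exact: finite_ssyt]. Qed.

Let rest m := msetB m (msetn (m n) n).

(** Tableaux of shape [lam] and content [m] are sorted by the shape left after
    stripping; [strip n] and [fill n lam] are inverse bijections between each
    class and the tableaux of the smaller shape. *)
Lemma coef_schur_branch m : all (gtn n.+1) m ->
  coef (schur lam) m =
  \sum_(e : {ffun 'I_k -> bool} | vstrip mu e && (\sum_i e i == m n)%N)
    coef (schur (lam' e)) (rest m).
Proof.
move=> mn; rewrite coef_schur.
have Tmn T : seq_mset (flatten T) = m -> all (gtn n.+1) (flatten T).
  by move=> Tm; rewrite -(perm_all _ (perm_eq_seq_mset (flatten T))) Tm.
have countT T x : seq_mset (flatten T) = m -> count_mem x (flatten T) = m x.
  by move=> <-; rewrite mset_seqE.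
(* Count each tableau through the one [e] that describes its stripped shape. *)
pose Q e T := [&& vstrip mu e, (\sum_i e i == m n)%N & shape (strip n T) == lam' e].
transitivity (\sum_(T <- fset_set (tabs lam m)) \sum_(e | Q e T) (1 : int)).
  rewrite big_seq (eq_bigr (fun=> 1)); last first.
    move=> T /mem_tabs[ssT Tm].
    have [e st sh] := shape_strip ssT (Tmn _ Tm).
    rewrite (big_pred1 e) // => e' /=; apply/idP/eqP => [/and3P[st' _]| ->].
      by rewrite sh => /eqP E; apply: conj_shrink_inj.
    rewrite /Q st sh eqxx andbT /=.
    have := sumn_conj_shrink st; have [<- _ _] := ssT.
    by rewrite (sumn_shape_strip (Tmn _ Tm)) countT // sh => /addnI ->.
  by rewrite -big_seq big_const_seq count_predT iter_addr addr0.
rewrite (exchange_big_dep (fun e => vstrip mu e && (\sum_i e i == m n)%N)); last first.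
  by move=> T e _ /and3P[-> ->].
apply: eq_bigr => e /andP[st em]; rewrite coef_schur.
rewrite (eq_bigl (Q e)) // -big_filter big_const_seq count_predT iter_addr addr0.
congr (_ %:R); rewrite -(size_map (strip n)); apply: perm_size.
have size_lam' : size (lam' e) = size lam by rewrite !size_conjpart.
have fillK T : is_ssyt lam T -> all (gtn n.+1) (flatten T) ->
    fill n lam (strip n T) = T.
  by move=> ssT Tn; exact: fill_strip.
apply: uniq_perm; rewrite ?fset_uniq //.
  rewrite map_inj_in_uniq ?filter_uniq ?fset_uniq // => T T'.
  rewrite !mem_filter => /andP[_ /mem_tabs[ssT Tm]] /andP[_ /mem_tabs[ssT' Tm']] E.
  by rewrite -(fillK T) ?E ?fillK //; apply: Tmn.
move=> T'; apply/mapP/idP => [[T] | /mem_tabs[ssT' Tm']].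
  rewrite mem_filter => /andP[/and3P[_ _ /eqP sh] /mem_tabs[ssT Tm]] ->.
  apply/mem_tabs; split; first by rewrite -sh; apply: strip_ssyt ssT _ _; rewrite ?Tmn.
  apply/msetP => x; rewrite mset_seqE flatten_strip count_filter.
  rewrite msetE2 msetnE; case: eqVneq => [->|xn].
    rewrite subnn (@eq_count _ _ pred0) ?count_pred0 // => y /=.
    by case: eqP => // ->; rewrite ltnn.
  rewrite subn0 -(countT T) //; apply: eq_in_count => y yT /=; case: eqP => // yx.
  have /allP/(_ _ yT) /= := Tmn _ Tm; rewrite ltnS leq_eqVlt yx.
  by rewrite (negbTE xn).
have Tn' : all (gtn n) (flatten T').
  rewrite -(perm_all _ (perm_eq_seq_mset (flatten T'))) Tm'.
  apply/all_ltn_mset => i ni; rewrite msetE2 msetnE; case: eqVneq => [->|]; first by rewrite subnn.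
  by move/eqP => ?; move/all_ltn_mset: mn => -> //; lia.
have le_lam i : (nth 0%N (lam' e) i <= nth 0%N lam i)%N.
  rewrite leqNgt; apply/negP => H.
  by have := lt_lam' i (nth 0%N lam i) st; rewrite H; have := lt_lam i (nth 0%N lam i); rewrite ltnn; lia.
have ge_lam i : (nth 0%N lam i.+1 <= nth 0%N (lam' e) i)%N.
  rewrite leqNgt; apply/negP; set j := nth 0%N (lam' e) i => H.
  have := lt_lam' i j st; rewrite ltnn; have := lt_lam i.+1 j; rewrite H.
  by case: (ext e j); lia.
have ssT := fill_ssyt ssT' Tn' le_lam ge_lam size_lam'.
exists (fill n lam T'); last by rewrite (strip_fill ssT').
rewrite mem_filter /Q st em (strip_fill ssT') //=; have [-> _ _] := ssT'.
rewrite eqxx /=; apply/mem_tabs; split => //.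
have sT' : size T' = size lam.
  by rewrite -size_lam'; have [<- _ _] := ssT'; rewrite size_map.
apply/msetP => x; rewrite mset_seqE count_fill //; last first.
  by move=> i; rewrite -nth_shape; have [-> _ _] := ssT'.
have [-> _ _] := ssT'; rewrite (sumn_conj_shrink st) addKn (eqP em).
rewrite -mset_seqE Tm' msetE2 msetnE; case: eqVneq => [->|_].
  by rewrite mul1n subnK.
by rewrite mul0n addn0 subn0.
Qed.

End Branching.

Lemma coef_sum I (r : seq I) (P : pred I) (F : I -> fps) m :
  coef (\sum_(i <- r | P i) F i) m = \sum_(i <- r | P i) coef (F i) m.
Proof. by apply: (big_morph (fun f => coef f m)). Qed.

(** The branching rule.  The power of [var n] shifts a monomial by copies of
    [n], and the truncation keeps the term for which no copy is left. *)
Lemma schur_truncvarS n k L mu : is_part k mu -> (mu 0%N <= L)%N ->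
  truncvar n.+1 (schur (conjpart k L mu)) =
  \sum_(e : {ffun 'I_k -> bool} | vstrip mu e)
     var n ^+ (\sum_i e i) * truncvar n (schur (conjpart k L (shrink mu e))).
Proof.
move=> pmu muL; apply: fpsP => m; rewrite coef_sum.
rewrite -[LHS]/(if _ then coef (schur _) m else 0).
under eq_bigr do rewrite coef_varXM.
have [mn|mn] := boolP (all _ _).
  rewrite (coef_schur_branch pmu muL mn) big_mkcondr.
  apply: eq_bigr => e st; set c := (\sum_i e i)%N.
  case: (ltngtP c (m n)) => [lt|//|E].
    rewrite -[RHS]/(if _ then coef (schur _) _ else 0) ifN //.
    apply/negP => /all_ltn_mset /(_ n (leqnn n)); rewrite msetE2 msetnxx; lia.
  rewrite -[RHS]/(if _ then coef (schur _) _ else 0) E ifT //.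
  apply/all_ltn_mset => i ni; rewrite msetE2 msetnE.
  case: eqVneq => [->|]; first by rewrite subnn.
  by move/eqP => ?; move/all_ltn_mset: mn => -> //; lia.
rewrite big1 // => e _; case: ifP => // _.
rewrite -[LHS]/(if _ then coef (schur _) _ else 0) ifN //.
apply: contra mn => /all_ltn_mset mn; apply/all_ltn_mset => i ni.
by have := mn i (ltnW ni); rewrite msetE2 msetnE gtn_eqF // subn0.
Qed.

Lemma schur_truncvar0 k L mu : is_part k mu -> (mu 0%N <= L)%N ->
  truncvar 0 (schur (conjpart k L mu)) = (mu 0%N == 0%N)%:R.
Proof.
move=> pmu muL; transitivity (truncvar 0 (mu 0%N == 0%N)%:R); last first.
  by case: (_ == _); rewrite ?rmorph1 ?rmorph0.
apply: fpsP => m; rewrite /truncvar.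
rewrite -[LHS]/(if _ then coef (schur _) m else 0).
rewrite -[RHS]/(if _ then coef _ m else 0).
case: ifP => // /all_ltn_mset m0.
have -> : m = mset0 by apply/msetP => i; rewrite mset0E m0.
have flat0 T : seq_mset (flatten T) = mset0 -> flatten T = [::].
  move=> E; apply/eqP; rewrite -size_eq0 -(perm_size (perm_eq_seq_mset _)).
  by rewrite E enum_mset0.
have sum_mu T : is_ssyt (conjpart k L mu) T ->
    (\sum_(j < k) mu j)%N = size (flatten T).
  by move=> [sh _ _]; rewrite -(sumn_conjpart pmu muL) size_flatten sh.
have [_ muk] := pmu; have [mon _] := pmu.
have [mu0|mu0] := eqVneq (mu 0%N) 0%N; last first.
  rewrite /= (_ : [set T | _] = set0) ?fsbig_set0 //.
  apply/seteqP; split=> // T /= [/sum_mu sh /flat0 T0].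
  move: sh; rewrite T0 /=; have [k0|k0] := posnP k.
    by rewrite muk ?k0 in mu0.
  by rewrite (bigD1 (Ordinal k0)) //=; lia.
have mu_0 j : mu j = 0%N by apply/eqP; rewrite -leqn0 -mu0 mon.
have lamE : conjpart k L mu = nseq L 0%N.
  apply: (@eq_from_nth _ 0%N) => [|i]; rewrite size_conjpart ?size_nseq // => iL.
  by rewrite nth_mkseq // nth_nseq iL big1 // => j _; rewrite mu_0.
rewrite [RHS]/= eqxx lamE /= (_ : [set T | _] = [set nseq L [::]]) ?fsbig_set1 //.
apply/seteqP; split => [T /= [ssT /flat0 T0] | T /= ->].
  apply: (@eq_from_nth _ [::]) => [|i iT].
    by case: ssT => sh _ _; rewrite size_nseq -(size_map size) -/(shape T) sh size_nseq.
  rewrite nth_nseq if_same; apply/eqP; rewrite -size_eq0 -nth_shape.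
  by case: ssT => -> _ _; rewrite nth_nseq if_same.
split; last by apply/msetP => x; rewrite mset_seqE mset0E; elim: (L).
split=> [|i|i j]; rewrite ?nth_nseq ?if_same //.
by rewrite /shape map_nseq.
Qed.

(** Both sides have the same branching rule and the same value in zero
    variables. *)
Theorem dual_jacobi_trudi k L mu : is_part k mu -> (mu 0%N <= L)%N ->
  schur (conjpart k L mu) = jt elemsym k mu.
Proof.
move=> pmu muL; apply: truncvar_inj => n.
rewrite /jt rmorph_jtdet -/(jt _ k mu).
elim: n mu pmu muL => [|n IH] mu pmu muL.
  rewrite (jt_delta _ pmu) ?schur_truncvar0 // => l /=.
  exact: truncvar0_elemsym.
rewrite (schur_truncvarS _ pmu muL).
rewrite (@jt_add_var _ _ (truncvar n \o elemsym) (var n) _ _ _ _ pmu).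
- apply: eq_bigr => e st; rewrite IH //; first exact: shrink_part.
  by apply: leq_trans muL; rewrite leq_subr.
- by move=> l l0 /=; rewrite elemsym_neg ?rmorph0.
- by move=> l /=; exact: truncvar_elemsymS.
Qed.

(** * Summation of minors of order four *)

Section Minors.
Variables (R : comNzRingType) (M : nat -> nat -> R).

Definition minor2 i j a b := M a i * M b j - M a j * M b i.

Definition minor4 a b c d : R :=
  \det (\matrix_(i < 4, j < 4) M (nth 0%N [:: a; b; c; d] i) j).

(** Expansion along the first two rows. *)
Lemma minor4_laplace a b c d :
  minor4 a b c d =
    minor2 0 1 a b * minor2 2 3 c d - minor2 0 2 a b * minor2 1 3 c d
  + minor2 0 3 a b * minor2 1 2 c d + minor2 1 2 a b * minor2 0 3 c d
  - minor2 1 3 a b * minor2 0 2 c d + minor2 2 3 a b * minor2 0 1 c d.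
Proof.
rewrite /minor4 /minor2.
rewrite (expand_det_row _ ord0) !big_ord_recl big_ord0 /cofactor.
rewrite !(expand_det_row _ ord0) !big_ord_recl !big_ord0 /cofactor.
rewrite !(expand_det_row _ ord0) !big_ord_recl !big_ord0 /cofactor !det_mx11.
by rewrite !mxE /bump /=; ring.
Qed.


Lemma minor4_swap12 a b c d : minor4 b a c d = - minor4 a b c d.
Proof. by rewrite !minor4_laplace /minor2; ring. Qed.

Lemma minor4_swap23 a b c d : minor4 a c b d = - minor4 a b c d.
Proof. by rewrite !minor4_laplace /minor2; ring. Qed.

Lemma minor4_swap34 a b c d : minor4 a b d c = - minor4 a b c d.
Proof. by rewrite !minor4_laplace /minor2; ring. Qed.

Lemma minor4_eq13 a b d : minor4 a b a d = 0.
Proof. by rewrite !minor4_laplace /minor2; ring. Qed.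

Lemma minor4_eq23 a b d : minor4 a b b d = 0.
Proof. by rewrite !minor4_laplace /minor2; ring. Qed.

Lemma minor4_eq14 a b c : minor4 a b c a = 0.
Proof. by rewrite !minor4_laplace /minor2; ring. Qed.

Lemma minor4_eq24 a b c : minor4 a b c b = 0.
Proof. by rewrite !minor4_laplace /minor2; ring. Qed.

Definition dec4 a b c d := [&& (b < a)%N, (c < b)%N & (d < c)%N].

(** Two chains without common element merge into one in exactly one of six
    ways. *)
Lemma interleavings a b c d : a != c -> a != d -> b != c -> b != d ->
  (((b < a) && (d < c)) =
   dec4 a b c d + dec4 a c b d + dec4 a c d b + dec4 c a b d + dec4 c a d b
     + dec4 c d a b :> nat)%N.
Proof. rewrite /dec4; lia. Qed.

Definition alt4 a b c d := [&& odd (a + b), odd (b + c) & odd (c + d)].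

Section Sums.
Variables N s : nat.
Let Q := (('I_N * 'I_N) * ('I_N * 'I_N))%type.

Let t a b c d := minor4 a b c d *+ ([&& odd (a + b), odd (c + d) & a + b + c + d == s])%N.

Let S (F : nat -> nat -> nat -> nat -> R) := \sum_(x : Q) F x.1.1 x.1.2 x.2.1 x.2.2.

Let dS F := S (fun a b c d => F a b c d *+ dec4 a b c d).

Let eq_S F G : (forall a b c d, F a b c d = G a b c d) -> S F = S G.
Proof. by move=> FG; apply: eq_bigr. Qed.

Let S_swap23 F : S F = S (fun a b c d => F a c b d).
Proof.
rewrite /S (reindex_inj (h := fun x : Q => ((x.1.1, x.2.1), (x.1.2, x.2.2)))) //.
by move=> [[a b] [c d]] [[a' b'] [c' d']] /= [-> -> -> ->].
Qed.

Let S_swap12 F : S F = S (fun a b c d => F b a c d).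
Proof.
rewrite /S (reindex_inj (h := fun x : Q => ((x.1.2, x.1.1), x.2))) //.
by move=> [[a b] y] [[a' b'] z] /= [-> -> ->].
Qed.

Let S_swap34 F : S F = S (fun a b c d => F a b d c).
Proof.
rewrite /S (reindex_inj (h := fun x : Q => (x.1, (x.2.2, x.2.1)))) //.
by move=> [y [a b]] [z [a' b']] /= [-> -> ->].
Qed.

(** For a > b > c > d, and writing [ab] for the parity of a + b, the six
    interleavings contribute 2 (ab cd - ac bd + ad bc) times the minor.  If the
    parities alternate this is 2 (1 - 0 + 1); any other choice of parities
    makes the bracket vanish. *)
Lemma sum_interleave :
  \sum_(x : Q | [&& x.1.2 < x.1.1, x.2.2 < x.2.1, odd (x.1.1 + x.1.2),
                   odd (x.2.1 + x.2.2) & x.1.1 + x.1.2 + x.2.1 + x.2.2 == s]%N)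
     minor4 x.1.1 x.1.2 x.2.1 x.2.2 =
  (\sum_(x : Q | [&& dec4 x.1.1 x.1.2 x.2.1 x.2.2, alt4 x.1.1 x.1.2 x.2.1 x.2.2
                   & x.1.1 + x.1.2 + x.2.1 + x.2.2 == s]%N)
     minor4 x.1.1 x.1.2 x.2.1 x.2.2) *+ 4.
Proof.
transitivity (S (fun a b c d => t a b c d *+ ((b < a) && (d < c))%N)).
  rewrite big_mkcond; apply: eq_bigr => -[[a b] [c d]] _ /=; rewrite /t -mulrnA.
  case: (b < a)%N; case: (d < c)%N; rewrite /= ?muln0 ?muln1 ?mulr0n //.
  by case: (odd (a + b)); case: (odd (c + d)); case: (_ == s).
transitivity (S (fun a b c d => t a b c d *+ dec4 a b c d + t a b c d *+ dec4 a c b d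
    + t a b c d *+ dec4 a c d b + t a b c d *+ dec4 c a b d + t a b c d *+ dec4 c a d b
    + t a b c d *+ dec4 c d a b)).
  apply: eq_S => a b c d; rewrite -!mulrnDr.
  have [ac|ac] := eqVneq a c; first by rewrite /t ac minor4_eq13 !mul0rn.
  have [ad|ad] := eqVneq a d; first by rewrite /t ad minor4_eq14 !mul0rn.
  have [bc|bc] := eqVneq b c; first by rewrite /t bc minor4_eq23 !mul0rn.
  have [bd|bd] := eqVneq b d; first by rewrite /t bd minor4_eq24 !mul0rn.
  by rewrite interleavings.
rewrite /S !big_split /= -!/(S _).
transitivity (dS t + dS (fun a b c d => t a c b d) + dS (fun a b c d => t a d b c)
  + dS (fun a b c d => t b c a d) + dS (fun a b c d => t b d a c)
  + dS (fun a b c d => t c d a b)).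
  congr (_ + _ + _ + _ + _ + _).
  - exact: S_swap23.
  - by rewrite -[LHS]/(S (fun a b c d => t a b c d *+ dec4 a c d b)) [LHS]S_swap23 [LHS]S_swap34.
  - by rewrite -[LHS]/(S (fun a b c d => t a b c d *+ dec4 c a b d)) [LHS]S_swap23 [LHS]S_swap12.
  - by rewrite -[LHS]/(S (fun a b c d => t a b c d *+ dec4 c a d b)) [LHS]S_swap23 [LHS]S_swap12 [LHS]S_swap34.
  - by rewrite -[LHS]/(S (fun a b c d => t a b c d *+ dec4 c d a b))
       [LHS]S_swap23 [LHS]S_swap12 [LHS]S_swap34 [LHS]S_swap23.
rewrite /dS /S -!big_split /= -sumrMnl [RHS]big_mkcond.
apply: eq_bigr => -[[a b] [c d]] _ /=; case: (dec4 a b c d); rewrite ?mulr0n ?addr0 //.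
rewrite /t !mulr1n /=.
have -> : minor4 a c b d = - minor4 a b c d by rewrite minor4_swap23.
have -> : minor4 a d b c = minor4 a b c d.
  by rewrite minor4_swap23 minor4_swap34 opprK.
have -> : minor4 b c a d = minor4 a b c d.
  by rewrite minor4_swap23 minor4_swap12 opprK.
have -> : minor4 b d a c = - minor4 a b c d.
  by rewrite minor4_swap23 minor4_swap12 minor4_swap34 opprK.
have -> : minor4 c d a b = minor4 a b c d.
  by rewrite minor4_swap23 minor4_swap12 minor4_swap34 minor4_swap23 !opprK.
have -> : (a + c + b + d = a + b + c + d)%N by lia.
have -> : (a + d + b + c = a + b + c + d)%N by lia.
have -> : (b + c + a + d = a + b + c + d)%N by lia.
have -> : (b + d + a + c = a + b + c + d)%N by lia.
have -> : (c + d + a + b = a + b + c + d)%N by lia.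
rewrite /alt4 !oddD; move: (minor4 a b c d) => D.
by case: (odd a); case: (odd b); case: (odd c); case: (odd d); case: (_ == s) => /=; ring.
Qed.

End Sums.

End Minors.

(** The pairs a > b with a + b = 2p + 1 are (p + 1 + q, p - q) for q <= p. *)
Lemma sum_pairs_odd (V : nmodType) N p (F : nat -> nat -> V) : (p.*2 < N)%N ->
  \sum_(y : 'I_N.+1 * 'I_N.+1 | (y.2 < y.1)%N && (y.1 + y.2 == p.*2.+1)%N)
     F y.1 y.2 =
  \sum_(q < p.+1) F (p.+1 + q)%N (p - q)%N.
Proof.
move=> pN.
rewrite (reindex_onto
  (fun q : 'I_p.+1 => (inord (p.+1 + q) : 'I_N.+1, inord (p - q) : 'I_N.+1))
  (fun y => inord (p - y.2))) /=; last first.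
  move=> [a b] /= /andP[ba /eqP ab]; congr (_, _); apply: val_inj => /=.
    by rewrite !inordK //; lia.
  by rewrite !inordK //; lia.
have val1 (q : 'I_p.+1) : (inord (p.+1 + q) : 'I_N.+1) = (p.+1 + q)%N :> nat.
  by rewrite inordK //; have := ltn_ord q; lia.
have val2 (q : 'I_p.+1) : (inord (p - q) : 'I_N.+1) = (p - q)%N :> nat.
  by rewrite inordK //; lia.
apply: eq_big => [q | q _]; rewrite !val1 !val2 //.
have qp := ltn_ord q.
apply/andP; split; first by apply/andP; split; [lia | apply/eqP; lia].
by apply/eqP/val_inj; rewrite /= inordK; lia.
Qed.

Lemma sum_shift_telescope (V : zmodType) (h : nat -> V) n d :
  \sum_(q < n) (h q - h (q + d)%N) = \sum_(q < d) h q - \sum_(q < d) h (n + q)%N.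
Proof.
rewrite sumrB; apply/eqP; rewrite subr_eq addrAC eq_sym subr_eq; apply/eqP.
transitivity (\sum_(q < d + n) h q).
  rewrite big_split_ord /=; congr (_ + _).
  by apply: eq_bigr => q _; rewrite addnC.
by rewrite addnC big_split_ord.
Qed.

Section Shift.
Variables (R : comNzRingType) (e : int -> R).
Hypothesis e_neg : forall l, l < 0 -> e l = 0.

Definition shiftmx (a i : nat) : R := e (a%:Z - 3 + i%:Z).

(** With these pairs, the second product in the minor is the first one with [q]
    moved by the distance [d] of the columns, so the sum telescopes.  At its
    far end the second factors have index at most i + d - 4 < 0. *)
Lemma sum_minor2 i d p : (i + d <= 3)%N ->
  \sum_(q < p.+1) minor2 shiftmx i (i + d) (p.+1 + q) (p - q) =
  \sum_(q < d) e (p%:Z + i%:Z - 2 + q%:Z) * e (p%:Z + i%:Z + d%:Z - 3 - q%:Z).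
Proof.
move=> id3.
pose h q := e (p%:Z + i%:Z - 2 + q%:Z) * e (p%:Z + i%:Z + d%:Z - 3 - q%:Z).
transitivity (\sum_(q < p.+1) (h q - h (q + d)%N)).
  apply: eq_bigr => q _; have := ltn_ord q => qp.
  by rewrite /minor2 /shiftmx /h; congr (e _ * e _ - e _ * e _); lia.
rewrite sum_shift_telescope [X in _ - X]big1 ?subr0 // => q _.
by rewrite /h [X in _ * X]e_neg ?mulr0 //; lia.
Qed.

(** The sum of the 2x2 minors on columns [i] and [j] with row sum 2p + 1. *)
Let B i j p := \sum_(q < p.+1) minor2 shiftmx i j (p.+1 + q) (p - q).

Lemma sum_minor2_01 p : B 0 1 p = e (p%:Z - 2) ^+ 2.
Proof.
rewrite /B (@sum_minor2 0 1) // big_ord1 expr2 /=; congr (e _ * e _); lia.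
Qed.

Lemma sum_minor2_12 p : B 1 2 p = e (p%:Z - 1) ^+ 2.
Proof.
rewrite /B (@sum_minor2 1 1) // big_ord1 expr2 /=; congr (e _ * e _); lia.
Qed.

Lemma sum_minor2_23 p : B 2 3 p = e p%:Z ^+ 2.
Proof.
rewrite /B (@sum_minor2 2 1) // big_ord1 expr2 /=; congr (e _ * e _); lia.
Qed.

Lemma sum_minor2_02 p : B 0 2 p = 2 * e (p%:Z - 2) * e (p%:Z - 1).
Proof.
rewrite /B (@sum_minor2 0 2) // big_ord_recr big_ord1 /=.
have -> : 2 * e (p%:Z - 2) * e (p%:Z - 1) = e (p%:Z - 2) * e (p%:Z - 1) + e (p%:Z - 1) * e (p%:Z - 2) by ring.
by congr (e _ * e _ + e _ * e _); lia.
Qed.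

Lemma sum_minor2_13 p : B 1 3 p = 2 * e (p%:Z - 1) * e p%:Z.
Proof.
rewrite /B (@sum_minor2 1 2) // big_ord_recr big_ord1 /=.
have -> : 2 * e (p%:Z - 1) * e p%:Z = e (p%:Z - 1) * e p%:Z + e p%:Z * e (p%:Z - 1) by ring.
by congr (e _ * e _ + e _ * e _); lia.
Qed.

Lemma sum_minor2_03 p : B 0 3 p = 2 * e (p%:Z - 2) * e p%:Z + e (p%:Z - 1) ^+ 2.
Proof.
rewrite /B (@sum_minor2 0 3) // 2!big_ord_recr big_ord1 /=.
have -> : 2 * e (p%:Z - 2) * e p%:Z + e (p%:Z - 1) ^+ 2 =
  e (p%:Z - 2) * e p%:Z + e (p%:Z - 1) * e (p%:Z - 1) + e p%:Z * e (p%:Z - 2) by ring.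
by congr (e _ * e _ + e _ * e _ + e _ * e _); lia.
Qed.

(** The pairs (a, b) with a + b = 2p + 1 are matched with the pairs (c, d) with
    c + d = 2 (n - p) + 1; for given [p] the Laplace expansion factors the sum
    over the two. *)
Lemma sum_minor4_pairs n N : (n.*2 < N)%N ->
  \sum_(x : ('I_N.+1 * 'I_N.+1) * ('I_N.+1 * 'I_N.+1) |
         [&& x.1.2 < x.1.1, x.2.2 < x.2.1, odd (x.1.1 + x.1.2),
             odd (x.2.1 + x.2.2) & x.1.1 + x.1.2 + x.2.1 + x.2.2 == n.*2.+2]%N)
     minor4 shiftmx x.1.1 x.1.2 x.2.1 x.2.2 =
  \sum_(p < n.+1) (B 0 1 p * B 2 3 (n - p) - B 0 2 p * B 1 3 (n - p)
     + B 0 3 p * B 1 2 (n - p) + B 1 2 p * B 0 3 (n - p)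
     - B 1 3 p * B 0 2 (n - p) + B 2 3 p * B 0 1 (n - p)).
Proof.
move=> nN.
rewrite (partition_big (fun x : ('I_N.+1 * 'I_N.+1) * ('I_N.+1 * 'I_N.+1) =>
   inord (x.1.1 + x.1.2)./2 : 'I_n.+1) xpredT) //=.
apply: eq_bigr => p _.
have pn := ltn_ord p.
pose P m (y : 'I_N.+1 * 'I_N.+1) := (y.2 < y.1)%N && (y.1 + y.2 == m.*2.+1)%N.
rewrite (eq_bigl (fun x : ('I_N.+1 * 'I_N.+1) * ('I_N.+1 * 'I_N.+1) =>
   P p x.1 && P (n - p)%N x.2)); last first.
  move=> [[a b] [c d]]; rewrite /P /=.
  apply/andP/andP => [[/and5P[ba dc oab ocd /eqP s] /eqP pE]|].
    have := odd_double_half (a + b); have := odd_double_half (c + d).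
    rewrite oab ocd => cdE abE.
    have pE' : (a + b)./2 = p by rewrite -pE inordK //; lia.
    by rewrite ba dc -pE'; split; apply/eqP; lia.
  move=> [/andP[ba /eqP abE] /andP[dc /eqP cdE]].
  rewrite ba dc -addnA abE cdE /= !odd_double /=; split; first by apply/eqP; lia.
  by apply/eqP/val_inj; rewrite /= uphalf_double inordK.
rewrite -(pair_big (P p) (P (n - p)%N)
   (fun y z => minor4 shiftmx y.1 y.2 z.1 z.2)) /=.
rewrite (eq_bigr (fun y : 'I_N.+1 * 'I_N.+1 =>
  \sum_(q' < (n - p).+1) minor4 shiftmx y.1 y.2 ((n - p).+1 + q') (n - p - q'))).
  2: by move=> y _; rewrite (sum_pairs_odd (minor4 shiftmx y.1 y.2)) //; lia.
rewrite (sum_pairs_odd (fun a b => \sum_(q' < (n - p).+1)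
   minor4 shiftmx a b ((n - p).+1 + q') (n - p - q'))); last by lia.
rewrite /B !big_distrlr /= -!sumrN -!big_split /=.
apply: eq_bigr => q _.
rewrite -!sumrN -!big_split; apply: eq_bigr => q' _ /=.
by rewrite minor4_laplace.
Qed.

(** The Laplace terms come in pairs exchanged by p -> r + 1 - p, which gives a
    factor 2; the indices of the three remaining products are then shifted so
    that each sum starts at k = 0, the terms lost having a negative index. *)
Lemma sum_minor4_dec_alt (r N : nat) : (r.+1.*2 < N)%N ->
  (forall x y : R, x *+ 4 = y *+ 4 -> x = y) ->
  \sum_(x : ('I_N.+1 * 'I_N.+1) * ('I_N.+1 * 'I_N.+1) |
     [&& dec4 x.1.1 x.1.2 x.2.1 x.2.2, alt4 x.1.1 x.1.2 x.2.1 x.2.2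
      & x.1.1 + x.1.2 + x.2.1 + x.2.2 == r.+1.*2.+2]%N)
     minor4 shiftmx x.1.1 x.1.2 x.2.1 x.2.2 =
  \sum_(0 <= k < r.+1)
     (e (k%:Z - 1) * e (k%:Z - 1) * e (r%:Z - k%:Z) * e (r%:Z - k%:Z)
      + e (k%:Z - 2) * e k%:Z * e (r%:Z - k%:Z) * e (r%:Z - k%:Z)
      - 2 * e (k%:Z - 1) * e k%:Z * e (r%:Z - k%:Z - 1) * e (r%:Z - k%:Z)).
Proof.
move=> rN tf; apply: tf; rewrite -sum_interleave sum_minor4_pairs //.
pose f1 p := B 0 1 p * B 2 3 (r.+1 - p).
pose f2 p := B 0 2 p * B 1 3 (r.+1 - p).
pose f3 p := B 0 3 p * B 1 2 (r.+1 - p).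
transitivity ((\sum_(p < r.+2) (f1 p - f2 p + f3 p)) *+ 2).
  rewrite mulr2n [X in _ = _ + X](reindex_inj rev_ord_inj) /= -big_split.
  apply: eq_bigr => p _ /=; have pr := ltn_ord p.
  rewrite /f1 /f2 /f3 subSS (_ : r.+1 - (r.+1 - p) = p)%N; last by lia.
  ring.
rewrite (_ : 4 = 2 * 2)%N // mulrnA; congr (_ *+ 2).
rewrite -(big_mkord xpredT (fun p => f1 p - f2 p + f3 p)) big_split /=.
have s1 : \sum_(0 <= p < r.+2) (f1 p - f2 p) = \sum_(0 <= k < r.+1)
   (e (k%:Z - 1) ^+ 2 * e (r%:Z - k%:Z) ^+ 2
    - 4 * e (k%:Z - 1) * e k%:Z * e (r%:Z - k%:Z - 1) * e (r%:Z - k%:Z)).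
  rewrite big_nat_recl // {1}/f1 {1}/f2 sum_minor2_01 sum_minor2_02 e_neg //.
  rewrite expr0n !mulr0 !mul0r subr0 add0r big_nat [RHS]big_nat.
  apply: eq_bigr => k /andP[_ kr]; rewrite /f1 /f2 sum_minor2_01 sum_minor2_02 sum_minor2_23 sum_minor2_13 subSS.
  have -> : k.+1%:Z - 2 = k%:Z - 1 by lia.
  have -> : k.+1%:Z - 1 = k%:Z by lia.
  have -> : (r - k)%N%:Z = r%:Z - k%:Z by lia.
  ring.
have s3 : \sum_(0 <= p < r.+2) f3 p = \sum_(0 <= k < r.+1)
   (2 * e (k%:Z - 2) * e k%:Z + e (k%:Z - 1) ^+ 2) * e (r%:Z - k%:Z) ^+ 2.
  rewrite big_nat_recr // {2}/f3 subnn sum_minor2_12 e_neg // expr0n /= mulr0 addr0.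
  rewrite big_nat [RHS]big_nat.
  apply: eq_bigr => k /andP[_ kr]; rewrite /f3 sum_minor2_03 sum_minor2_12.
  by congr (_ * e _ ^+ 2); lia.
rewrite s1 s3 -big_split -sumrMnl /=; apply: eq_bigr => k _; ring.
Qed.

End Shift.

(** * The identity *)

Lemma fps_mulr4_inj (f g : fps) : f *+ 4 = g *+ 4 -> f = g.
Proof.
have coefMn h n m : coef (h *+ n) m = coef h m *+ n.
  by elim: n => // n IH; rewrite !mulrS -IH.
by move=> fg; apply: fpsP => m; have := congr1 (fun h => coef h m) fg; rewrite !coefMn; lia.
Qed.

Lemma part4321_conjpart m4 m3 m2 m1 : part4321 m4 m3 m2 m1 =
  conjpart 4 (m4 + m3 + m2 + m1)
    (nth 0 [:: m4 + m3 + m2 + m1; m4 + m3 + m2; m4 + m3; m4])%N.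
Proof.
apply: conjpartP => //.
- split; last by move=> i i4; rewrite nth_default.
  by move=> [|[|[|[|i]]]] [|[|[|[|j]]]] //= ij; rewrite ?nth_nil; lia.
- by rewrite /part4321 !size_cat !size_nseq; lia.
move=> i j; rewrite /part4321 !nth_cat !size_nseq !nth_nseq.
have [i4|i4] := ltnP i m4.
  by case: j => [|[|[|[|j]]]] //=; rewrite ?nth_nil; lia.
have [i3|i3] := ltnP (i - m4) m3.
  by case: j => [|[|[|[|j]]]] //=; rewrite ?nth_nil; lia.
have [i2|i2] := ltnP (i - m4 - m3) m2.
  by case: j => [|[|[|[|j]]]] //=; rewrite ?nth_nil; lia.
have [i1|i1] := ltnP (i - m4 - m3 - m2) m1;
  by case: j => [|[|[|[|j]]]] //=; rewrite ?nth_nil; lia.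
Qed.

(** The entries of the Jacobi-Trudi matrix have index mu_i - i + j, that is
    (a, b, c, d)_i - 3 + j. *)
Lemma schur_part4321 a b c d : dec4 a b c d ->
  schur (part4321 d (c - d.+1) (b - c.+1) (a - b.+1)) =
  minor4 (shiftmx elemsym) a b c d.
Proof.
move=> /and3P[ba cb dc]; rewrite part4321_conjpart dual_jacobi_trudi //; last first.
  split; last by move=> i i4; rewrite nth_default.
  by move=> [|[|[|[|i]]]] [|[|[|[|j]]]] //= ij; rewrite ?nth_nil; lia.
rewrite /jt /jtdet /minor4; congr (\det _); apply/matrixP => i j.
rewrite !mxE /shiftmx; congr (elemsym (_ + _)).
by case: i => -[|[|[|[|i]]]] //= _; lia.
Qed.

Lemma part4321_partition m4 m3 m2 m1 : is_partition (part4321 m4 m3 m2 m1).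
Proof.
split; last by rewrite /part4321 !mem_cat !mem_nseq !andbF.
rewrite sorted_pairwise; last by move=> y x z /= yx zy; exact: leq_trans zy yx.
have pn n x : pairwise geq (nseq n x).
  elim: n => //= n ->; rewrite andbT; apply/allP => y.
  by rewrite mem_nseq => /andP[_ /eqP ->] /=.
rewrite /part4321 !pairwise_cat !pn /= !andbT.
apply/and3P; split; apply/allrelP => x y; rewrite ?mem_cat !mem_nseq => /andP[_ /eqP ->] /=.
- by move=> /or3P[] /andP[_ /eqP ->].
- by move=> /orP[] /andP[_ /eqP ->].
- by move=> /andP[_ /eqP ->].
Qed.

Lemma sumn_part4321 m4 m3 m2 m1 :
  sumn (part4321 m4 m3 m2 m1) = (m4 * 4 + m3 * 3 + m2 * 2 + m1)%N.
Proof. by rewrite /part4321 !sumn_cat !sumn_nseq; lia. Qed.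

Lemma part4321_inj m4 m3 m2 m1 n4 n3 n2 n1 :
  part4321 m4 m3 m2 m1 = part4321 n4 n3 n2 n1 ->
  [/\ m4 = n4, m3 = n3, m2 = n2 & m1 = n1].
Proof.
move=> E; have cE x := congr1 (count_mem x) E.
move: (cE 4) (cE 3) (cE 2) (cE 1%N).
by rewrite /part4321 !count_cat !count_nseq /=; split; lia.
Qed.

Theorem theorem3p1 (r : nat) (hr : (1 <= r)%N) :
  \sum_(0 <= k < r.+1)
     (elemsym (k%:Z - 1) * elemsym (k%:Z - 1) * elemsym (r%:Z - k%:Z) * elemsym (r%:Z - k%:Z)
      + elemsym (k%:Z - 2) * elemsym k%:Z * elemsym (r%:Z - k%:Z) * elemsym (r%:Z - k%:Z)
      - 2 * elemsym (k%:Z - 1) * elemsym k%:Z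
          * elemsym (r%:Z - k%:Z - 1) * elemsym (r%:Z - k%:Z))
  = \sum_(lam \in [set lam : seq nat |
           [/\ is_partition lam, sumn lam = (2 * r - 2)%N &
               exists i4 i3 i2 i1 : nat,
                 lam = part4321 i4 (2 * i3) (2 * i2) (2 * i1)]])
      schur lam.
Proof.
(* Rows with sum 2r + 4 and b + c + d >= 3 are at most [N]. *)
pose N := r.+1.*2.+1.
rewrite -(@sum_minor4_dec_alt _ _ elemsym_neg r N (leqnn _) fps_mulr4_inj).
pose Q := (('I_N.+1 * 'I_N.+1) * ('I_N.+1 * 'I_N.+1))%type.
pose P (x : Q) := [&& dec4 x.1.1 x.1.2 x.2.1 x.2.2, alt4 x.1.1 x.1.2 x.2.1 x.2.2
  & x.1.1 + x.1.2 + x.2.1 + x.2.2 == r.+1.*2.+2]%N.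
pose phi (x : Q) := part4321 x.2.2 (x.2.1 - x.2.2.+1) (x.1.2 - x.2.1.+1) (x.1.1 - x.1.2.+1).
have phi_inj : {in P &, injective phi}.
  move=> [[a b] [c d]] [[a' b'] [c' d']] /and3P[/= /and3P[ba cb dc] _ _].
  move=> /and3P[/= /and3P[ba' cb' dc'] _ _] /part4321_inj[/= E1 E2 E3 E4].
  by congr ((_, _), (_, _)); apply: val_inj => /=; lia.
transitivity (\sum_(lam <- [seq phi x | x <- enum P]) schur lam).
  rewrite big_map big_enum_cond /=; apply: eq_big => [x|x /and3P[dx _ _]].
    by rewrite andbT.
  by rewrite schur_part4321.
rewrite fsbig_seq; last first.
  rewrite map_inj_in_uniq ?enum_uniq // => x y; rewrite !mem_enum; exact: phi_inj.
apply: eq_fsbigl; apply/seteqP; split=> [lam /= /mapP[x] | lam /= [_ lamr]].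
  rewrite mem_enum => /and3P[/and3P[ba cb dc] /and3P[oab obc ocd] /eqP sx] ->.
  split; first exact: part4321_partition.
    by rewrite sumn_part4321; lia.
  have odd_gap m n : (n < m)%N -> odd (m + n) -> (m - n.+1)%N = (2 * (m - n.+1)./2)%N.
    by move=> nm; rewrite oddD; lia.
  by exists x.2.2, (x.2.1 - x.2.2.+1)./2, (x.1.2 - x.2.1.+1)./2,
     (x.1.1 - x.1.2.+1)./2; rewrite -!odd_gap.
move=> [i4 [i3 [i2 [i1 lamE]]]]; move: lamr; rewrite lamE sumn_part4321 => lamr.
pose c := (i4 + 2 * i3).+1; pose b := (c + 2 * i2).+1; pose a := (b + 2 * i1).+1.
have val_inord m : (m <= a)%N -> (inord m : 'I_N.+1) = m :> nat.
  by move=> ma; rewrite inordK //; move: ma; rewrite /N /a /b /c; lia.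
pose x : Q := ((inord a, inord b), (inord c, inord i4)).
have [xa xb xc xd] : [/\ x.1.1 = a :> nat, x.1.2 = b :> nat, x.2.1 = c :> nat
   & x.2.2 = i4 :> nat].
  by split; rewrite val_inord // /a /b /c; lia.
apply/mapP; exists x.
  rewrite mem_enum; apply/and3P; rewrite xa xb xc xd /a /b /c; split.
  - by apply/and3P; split; lia.
  - by apply/and3P; split; lia.
  - by apply/eqP; lia.
rewrite /phi xa xb xc xd; congr part4321; rewrite /a /b /c; lia.
Qed.
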